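(* Let $k\geq 3$. Every graph $G$ with maximum degree $\Delta(G)\le k$ is $(1^{k-1},2^{k})$-packing colorable.
   Context: Graphs are finite and simple; $\mathrm{dist}(x,y)$ is the usual shortest-path distance. For a non-decreasing sequence of positive integers $S=(s_1,\dots,s_p)$, an $S$-packing coloring of $G$ is a partition of $V(G)$ into sets $V_1,\dots,V_p$ such that any two distinct vertices of $V_i$ are at distance greater than $s_i$, for each $1\le i\le p$; $G$ is $S$-packing colorable if such a partition exists. The notation $i^r$ in a sequence means that $i$ is repeated $r$ times, so $(1^{k-1},2^{k})$ is the sequence of $k-1$ ones followed by $k$ twos. *)

(* Defs.v *)
From mathcomp Require Import all_boot.

Set Implicit Arguments.
Unset Strict Implicit.
Unset Printing Implicit Defensive.

Record sgraph := SGraph {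
  vertex :> finType;
  adj : rel vertex;
  adj_sym : symmetric adj;
  adj_irrefl : irreflexive adj }.

Definition degree (G : sgraph) (x : G) : nat := #|[set y : G | adj x y]|.

Definition max_degree (G : sgraph) : nat := \max_(x : G) degree x.

Definition has_walk (G : sgraph) (x y : G) (n : nat) : bool :=
  [exists p : n.-tuple G, path (@adj G) x p && (last x p == y)].

(* Shortest-path distance; None stands for the infinite distance between two
   different connected components. The search may stop at #|G|, since a
   shortest path visits no vertex twice (see distP and dist_NoneP). *)
Definition dist (G : sgraph) (x y : G) : option nat :=
  let n := find (has_walk x y) (iota 0 #|G|) in
  if n < #|G| then Some n else None.

Definition dist_gt (G : sgraph) (x y : G) (s : nat) : bool :=
  if dist x y is Some d then s < d else true.

(* The classes V i may be empty, and are numbered from 0, so that V i is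
   governed by the entry nth 0 S i. *)
Definition packing_coloring (S : seq nat) (G : sgraph)
    (V : 'I_(size S) -> {set G}) : Prop :=
  [/\ forall x : G, exists i, x \in V i,
      forall i j, i != j -> [disjoint V i & V j]
    & forall i (x y : G), x \in V i -> y \in V i -> x != y ->
        dist_gt x y (nth 0 S i)].

Definition packing_colorable (S : seq nat) (G : sgraph) : Prop :=
  exists V : 'I_(size S) -> {set G}, packing_coloring V.

Section DistFacts.
Variable G : sgraph.
Implicit Types x y : G.

Lemma has_walkP x y n :
  reflect (exists p : seq G, [/\ size p = n, path (@adj G) x p & last x p = y])
          (has_walk x y n).
Proof.
apply: (iffP existsP) => [[p /andP[xp /eqP <-]] | [p [sz_p xp <-]]].
  by exists p; rewrite size_tuple.
by exists (tcast sz_p (in_tuple p)); rewrite val_tcast /= xp eqxx.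
Qed.

Lemma has_walk_short x y n :
  has_walk x y n -> exists2 m, m <= n & (m < #|G|) && has_walk x y m.
Proof.
case/has_walkP=> p [<- + <-]; case/shortenP=> q xq uq sub_qp.
exists (size q); first by apply: uniq_leq_size => //; case/andP: uq.
apply/andP; split; last by apply/has_walkP; exists q.
by move/card_uniqP: uq => /= <-; apply: max_card.
Qed.

Lemma distP x y d :
  dist x y = Some d <->
  has_walk x y d /\ (forall n, has_walk x y n -> d <= n).
Proof.
rewrite /dist; set s := iota 0 #|G|; set n0 := find _ _.
have sz_s : size s = #|G| by rewrite size_iota.
have n0_min n : has_walk x y n -> n0 <= n.
  case/has_walk_short=> m le_mn /andP[lt_m w_m]; apply: leq_trans le_mn.
  rewrite leqNgt; apply/negP => /(before_find 0).
  by rewrite nth_iota // add0n w_m.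
have n0_walk : n0 < #|G| -> has_walk x y n0.
  move=> lt_n0; have h : has (has_walk x y) s by rewrite has_find sz_s.
  by have := nth_find 0 h; rewrite nth_iota.
case: ifP => [lt_n0 | /negbT ge_n0]; split=> //.
- by case=> <-; split; [exact: n0_walk | exact: n0_min].
- case=> w_d d_min; congr Some; apply/eqP.
  by rewrite eqn_leq n0_min //= d_min // n0_walk.
- case=> /has_walk_short[m _ /andP[lt_m w_m]] _.
  by case/negP: ge_n0; apply: leq_ltn_trans lt_m; apply: n0_min.
Qed.

Lemma dist_NoneP x y : dist x y = None <-> ~~ connect (@adj G) x y.
Proof.
split=> [dN | nc].
  apply/negP => /connectP[p xp y_p].
  have [|m _ /andP[lt_m w_m]] := @has_walk_short x y (size p).
    by apply/has_walkP; exists p.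
  move: dN; rewrite /dist; case: ifP => // /negP[].
  have h : has (has_walk x y) (iota 0 #|G|).
    by apply/hasP; exists m => //; rewrite mem_iota.
  by rewrite -[X in _ < X](size_iota 0) -has_find.
case d_xy: (dist x y) => [d|//]; case/negP: nc.
have [/has_walkP[p [_ xp <-]] _] := (distP x y d).1 d_xy.
by apply/connectP; exists p.
Qed.

End DistFacts.

(* Main.v *)
(** Choose a smallest set R such that G - R is properly (k-1)-colorable, and
    then a partial coloring of R by k colors, no two vertices of the same color
    being within distance 2, with as few uncolored vertices as possible. Suppose
    that x in R is uncolored (the token), and let S = R - x. Then
    x has at most one neighbour in S, sees all k colors within distance 2, and
    can hand the token to any neighbour q for which G - (S + q) is still
    (k-1)-colorable. Counting colors seen around the token shows that x has
    exactly one neighbour y in S, that all its other neighbours can receive the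
    token and also have exactly one neighbour in S, and that the k vertices of S
    met in this way carry k different colors. Now give x the color of y and
    make y the token, hand the token to a neighbour z <> x of y, and finally
    give z the color of x and make x the token again: x then has no neighbour
    in S - y + z, a contradiction. *)

Require Import Defs.
From mathcomp Require Import all_boot zify.

Set Implicit Arguments.
Unset Strict Implicit.
Unset Printing Implicit Defensive.

(** * Distances above 1 and 2 through adjacency *)

Section Distance.
Variable G : sgraph.
Implicit Types x y : G.

Definition nbhd x : {set G} := [set y | adj x y].

(** Distance at most 2 for distinct vertices; it also holds for [x = y] when [x] has a neighbour, so
    it is applied to distinct vertices only. *)
Definition close x y := adj x y || [exists w, adj x w && adj w y].

Lemma nbhd_sym x y : (y \in nbhd x) = (x \in nbhd y).
Proof. by rewrite !inE adj_sym. Qed.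

Lemma nbhd_irrefl x : x \notin nbhd x.
Proof. by rewrite inE adj_irrefl. Qed.

Lemma dist_gt1 x y : x != y -> ~~ adj x y -> dist_gt x y 1.
Proof.
move=> ne_xy nadj; rewrite /dist_gt; case d_xy: (dist x y) => [d|//].
have [/has_walkP[p [<- xp y_p]] _] := (distP x y d).1 d_xy.
case: p xp y_p => [|a [|b p]] //= => [_ /eqP|]; first by rewrite (negPf ne_xy).
by rewrite andbT => xa ya; rewrite -ya xa in nadj.
Qed.

Lemma dist_gt2 x y : x != y -> ~~ close x y -> dist_gt x y 2.
Proof.
move=> ne_xy /norP[nadj nwalk]; have := dist_gt1 ne_xy nadj.
rewrite /dist_gt; case d_xy: (dist x y) => [d|//] d_gt1.
rewrite ltn_neqAle d_gt1 andbT; apply: contra nwalk => /eqP d2.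
have [/has_walkP[p [sz_p xp y_p]] _] := (distP x y d).1 d_xy.
case: p sz_p xp y_p => [|a [|b [|e p]]] //=; try lia.
by move=> _; rewrite andbT => xab <-; apply/existsP; exists a.
Qed.

End Distance.

(** * Proper colorings outside a vertex set *)

Section ProperOff.
Variables (G : sgraph) (n : nat).
Implicit Types (S T : {set G}) (x q : G) (f : {ffun G -> 'I_n}).

(** [f] is total and its values on [S] are ignored, so the same [f] serves when [S] grows. *)
Definition proper_off S (f : {ffun G -> 'I_n}) :=
  [forall u, forall v, [&& u \notin S, v \notin S & adj u v] ==> (f u != f v)].

Definition colorable_off S := [exists f, proper_off S f].

Definition upd (T : Type) (f : {ffun G -> T}) x (j : T) : {ffun G -> T} :=
  [ffun v => if v == x then j else f v].

Lemma proper_offP S f :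
  reflect (forall u v, u \notin S -> v \notin S -> adj u v -> f u != f v)
          (proper_off S f).
Proof.
apply: (iffP forallP) => [H u v uS vS uv | H u].
  by have /forallP/(_ v) := H u; rewrite uS vS uv.
by apply/forallP => v; apply/implyP => /and3P[]; apply: H.
Qed.

Lemma proper_off_sub S T f : S \subset T -> proper_off S f -> proper_off T f.
Proof.
move=> sST /proper_offP Hf; apply/proper_offP => u v uT vT.
by apply: Hf; [move: uT | move: vT]; apply/contra/subsetP.
Qed.

Lemma proper_off_upd S x f j :
  proper_off (x |: S) f -> (forall q, q \in nbhd x :\: S -> f q != j) ->
  proper_off S (upd f x j).
Proof.
move=> /proper_offP Hf Hj; apply/proper_offP => u v uS vS uv; rewrite !ffunE.
have [ux|ux] := eqVneq u x; have [vx|vx] := eqVneq v x.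
- by move: uv; rewrite ux vx adj_irrefl.
- by rewrite eq_sym Hj // !inE vS -ux.
- by rewrite Hj // !inE uS -vx adj_sym.
- by apply: Hf; rewrite // !inE negb_or ?ux ?vx.
Qed.

(** If [j] were missing around [x], giving it to [x] would color [G - S]. *)
Lemma colors_seen S x f (j : 'I_n) :
  proper_off (x |: S) f -> ~~ colorable_off S ->
  exists2 q, q \in nbhd x :\: S & f q = j.
Proof.
move=> Hf nS; suff /exists_inP[q qx /eqP] : [exists q in nbhd x :\: S, f q == j].
  by exists q.
apply: contraR nS => /exists_inPn Hj; apply/existsP; exists (upd f x j).
exact: proper_off_upd.
Qed.

Lemma card_onto (f : {ffun G -> 'I_n}) (A : {set G}) :
  (forall j, exists2 q, q \in A & f q = j) -> n <= #|f @: A|.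
Proof.
move=> HA; rewrite -[X in X <= _]card_ord -cardsT.
by apply/subset_leq_card/subsetP => j _; have [q qA <-] := HA j; apply: imset_f.
Qed.

(** Giving [x] the color of [q] can conflict only at [q], which is excluded in exchange. *)
Lemma colorable_off_swap S x q f :
  proper_off (x |: S) f ->
  (forall w, w \in nbhd x :\: S -> w != q -> f w != f q) ->
  colorable_off (q |: S).
Proof.
move=> Hf Hq; apply/existsP; exists (upd f x (f q)); apply: proper_off_upd.
  by apply: proper_off_sub Hf; rewrite setUCA subsetUr.
by move=> w; rewrite !inE negb_or -andbA => /and3P[wq wS xw]; rewrite Hq // !inE wS.
Qed.

End ProperOff.


(** As no [Col q] has two colors, choosing for each color a [q] that carries it injects [k] colors
    into at most [k] elements, hence is a bijection. *)
Lemma cover_rainbow (T : finType) (k : nat) (A : {set T}) (Col : T -> {set 'I_k}) :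
  #|A| <= k -> (forall q, q \in A -> #|Col q| <= 1) ->
  (forall a, exists2 q, q \in A & a \in Col q) ->
  (forall q, q \in A -> exists a, a \in Col q) /\
  (forall q1 q2 a, q1 \in A -> q2 \in A -> a \in Col q1 -> a \in Col q2 ->
    q1 = q2).
Proof.
move=> leAk Col1 cov.
pose g a := s2val (sig2W (cov a)).
have gA a : g a \in A by rewrite /g; case: (sig2W _).
have gC a : a \in Col (g a) by rewrite /g; case: (sig2W _).
have uniqC q a b : q \in A -> a \in Col q -> b \in Col q -> a = b.
  by move=> /Col1/card_le1_eqP eqC aq bq; apply: eqC.
have g_inj : injective g.
  by move=> a b gab; apply: (uniqC (g a)); rewrite // gab.
have defA : g @: [set: 'I_k] = A.
  apply/eqP; rewrite eqEcard card_imset // cardsT card_ord leAk andbT.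
  by apply/subsetP => _ /imsetP[a _ ->].
have gE q a : q \in A -> a \in Col q -> q = g a.
  move=> qA; move: (qA); rewrite -{1}defA => /imsetP[b _ ->] aq.
  by rewrite (uniqC (g b) a b).
split=> [q | q1 q2 a q1A q2A /(gE _ _ q1A)-> /(gE _ _ q2A)-> //].
by rewrite -{1}defA => /imsetP[b _ ->]; exists b.
Qed.

(** * Partial distance-2 colorings and tokens *)

Section Token.
Variables (G : sgraph) (k : nat).
Implicit Types (R S : {set G}) (c : {ffun G -> option 'I_k}) (x y q s : G).

Definition valid R c :=
  [forall u, forall v, [&& u \in R, v \in R, u != v, c u == c v & c u != None]
    ==> ~~ close u v].

Definition uncolored R c := [set v in R | c v == None].

Lemma validP R c :
  reflect (forall u v a, u \in R -> v \in R -> u != v ->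
             c u = Some a -> c v = Some a -> ~~ close u v)
          (valid R c).
Proof.
apply: (iffP forallP) => [H u v a uR vR uv cu cv | H u].
  by have /forallP/(_ v) := H u; rewrite uR vR uv cu cv eqxx.
apply/forallP => v; apply/implyP => /and5P[uR vR uv /eqP cuv].
by case cu: (c u) => [a|//] _; apply: (H u v a); rewrite -?cuv.
Qed.

Lemma valid_sub R S c : S \subset R -> valid R c -> valid S c.
Proof.
move=> /subsetP sSR /validP H; apply/validP => u v a uS vS.
by apply: H; apply: sSR.
Qed.

Lemma close_sym x y : close x y = close y x.
Proof.
rewrite /close adj_sym; congr (_ || _).
by apply/existsP/existsP => -[w /andP[xw wy]]; exists w; rewrite adj_sym wy adj_sym.
Qed.

Lemma valid_upd S c x a : x \notin S -> valid S c ->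
  (forall s, s \in S -> c s = Some a -> ~~ close x s) ->
  valid (x |: S) (upd c x (Some a)).
Proof.
move=> xS /validP H Hx; apply/validP => u v b; rewrite !inE !ffunE.
have [->|ux] := eqVneq u x; have [->|vx] := eqVneq v x; rewrite ?eqxx //=.
- by move=> _ vS _ [<-]; apply: Hx.
- by move=> uS _ _ cu [ab]; rewrite close_sym Hx // ab.
- by move=> uS vS; apply: H.
Qed.

Lemma uncolored_upd S c x a :
  x \notin S -> uncolored (x |: S) (upd c x (Some a)) = uncolored S c.
Proof.
move=> xS; apply/setP => v; rewrite !inE ffunE.
by have [->|] := eqVneq v x; rewrite //= (negPf xS).
Qed.

Definition seen S c q : {set 'I_k} :=
  [set a | [exists s in nbhd q :&: S, c s == Some a]].

Lemma seenP S c q a :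
  reflect (exists s, [/\ s \in nbhd q, s \in S & c s = Some a]) (a \in seen S c q).
Proof.
rewrite inE; apply: (iffP exists_inP) => [[s] | [s [sq sS /eqP cs]]].
  by rewrite in_setI => /andP[? ?] /eqP; exists s.
by exists s; rewrite // in_setI sq.
Qed.

Lemma card_seen S c q : #|seen S c q| <= #|nbhd q :&: S|.
Proof.
apply: leq_trans (leq_imset_card c _).
rewrite -(card_imset (mem (seen S c q)) (@Some_inj _)).
apply/subset_leq_card/subsetP => _ /imsetP[a /seenP[s [sq sS <-]] ->].
by apply: imset_f; rewrite in_setI sq.
Qed.

Variables (rho m : nat).
Hypotheses (k_ge3 : 3 <= k) (deg_le : forall x, #|nbhd x| <= k).
Hypothesis rho_min : forall R, colorable_off k.-1 R -> rho <= #|R|.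
Hypothesis m_min : forall R c,
  colorable_off k.-1 R -> #|R| = rho -> valid R c -> m <= #|uncolored R c|.

(* [m] and [rho] being minimal, a token is an uncolored vertex [x] of the optimal
   pair [x |: S], [c]; the values of [c] outside [S] are irrelevant. *)
Definition token S c x :=
  [/\ x \notin S, colorable_off k.-1 (x |: S), valid S c, #|S|.+1 = rho
    & #|uncolored S c| < m].

Lemma token_ncol S c x : token S c x -> ~~ colorable_off k.-1 S.
Proof. by case=> _ _ _ cS _; apply/negP => /rho_min; rewrite -cS ltnn. Qed.

Lemma token_swap S c x q :
  token S c x -> q \notin S -> colorable_off k.-1 (q |: S) -> token S c q.
Proof. by case. Qed.

Lemma nbhd_out_ge S x :
  colorable_off k.-1 (x |: S) -> ~~ colorable_off k.-1 S ->
  k.-1 <= #|nbhd x :\: S|.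
Proof.
move=> /existsP[f Hf] nS; apply: leq_trans (leq_imset_card f _).
by apply: card_onto => j; apply: colors_seen.
Qed.

(** At least [k - 1] of the at most [k] neighbours lie outside [S]. *)
Lemma nbhd_in_le1 S x :
  colorable_off k.-1 (x |: S) -> ~~ colorable_off k.-1 S ->
  #|nbhd x :&: S| <= 1.
Proof.
move=> cS nS; have := nbhd_out_ge cS nS; have := deg_le x.
by rewrite -(cardsID S (nbhd x)); lia.
Qed.

Lemma token_in_le1 S c x : token S c x -> #|nbhd x :&: S| <= 1.
Proof. by move=> t; apply: nbhd_in_le1 (token_ncol t); case: t. Qed.

(* Two vertices of R = x |: S have no common neighbour in R, since a vertex of R
   has at most one neighbour there. *)
Lemma token_close S c x s : token S c x -> s \in S -> close x s ->
  exists2 q, q \in (x |: nbhd x) :\: S & s \in nbhd q.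
Proof.
move=> t sS; have [xS cS vS cardS unc] := t.
case/orP=> [xs | /existsP[w /andP[xw ws]]].
  by exists x; rewrite !inE ?eqxx ?xS.
have [wS | wS] := boolP (w \in S); last first.
  by exists w; rewrite !inE // wS xw orbT.
have : #|nbhd w :&: ((x |: S) :\ w)| <= 1.
  apply: nbhd_in_le1; first by rewrite setD1K // !inE wS orbT.
  apply/negP => /rho_min; rewrite -cardS.
  by have := cardsD1 w (x |: S); rewrite !inE wS orbT cardsU1 xS; lia.
have neq_ws : s != w by apply: contraTneq ws => ->; rewrite adj_irrefl.
have neq_xw : x != w by apply: contraNneq xS => ->.
move=> /card_le1_eqP/(_ s x); rewrite !inE eqxx sS ws orbT adj_sym xw neq_ws neq_xw.
by move=> /(_ isT isT) xs; rewrite xs sS in xS.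
Qed.

(** Otherwise [x] could receive the color [a], leaving fewer than [m] uncolored vertices. *)
Lemma token_sees S c x a : token S c x ->
  exists2 q, q \in (x |: nbhd x) :\: S & a \in seen S c q.
Proof.
move=> t; have [xS cS vS cardS unc] := t.
have /exists_inP[s sS /andP[/eqP cs xs]] :
    [exists s in S, (c s == Some a) && close x s].
  apply: contraTT unc => /exists_inPn Hs; rewrite -leqNgt.
  rewrite -(uncolored_upd c a xS); apply: m_min => //.
    by rewrite cardsU1 xS.
  apply: valid_upd => // s sS cs.
  by have := Hs s sS; rewrite cs eqxx.
have [q qA sq] := token_close t sS xs.
by exists q => //; apply/seenP; exists s.
Qed.

(** Since [y] is in [S], at most [k - 1] neighbours of [x] are outside, yet they show all [k - 1]
    colors; so [q] is the only one of its color. *)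
Lemma token_nbr_swap S c x y q : token S c x -> y \in nbhd x -> y \in S ->
  q \in nbhd x -> q \notin S -> token S c q.
Proof.
move=> t xy yS xq qS; apply: (token_swap t qS).
have [xS /existsP[f Hf] _ _ _] := t; apply: (colorable_off_swap Hf).
have ge_out : k.-1 <= #|f @: (nbhd x :\: S)|.
  by apply: card_onto => j; apply: colors_seen Hf (token_ncol t).
have in_gt0 : 0 < #|nbhd x :&: S| by apply/card_gt0P; exists y; rewrite in_setI xy.
have f_inj : {in nbhd x :\: S &, injective f}.
  apply/imset_injP; rewrite eqn_leq leq_imset_card (leq_trans _ ge_out) //.
  by have := deg_le x; rewrite -(cardsID S (nbhd x)); lia.
move=> w wx; apply: contraNneq => fwq; apply/eqP/f_inj => //.
by rewrite in_setD qS.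
Qed.

(** [y] is missing from [A], so [A] has at most [k] elements. Each is a token and sees at most one
    color, and together they see all [k]. *)
Lemma token_partner_rainbow S c x y : token S c x -> y \in nbhd x -> y \in S ->
  let A := (x |: nbhd x) :\: S in
  [/\ forall q, q \in A -> token S c q,
      forall q, q \in A -> exists a, a \in seen S c q
    & forall q1 q2 a, q1 \in A -> q2 \in A ->
        a \in seen S c q1 -> a \in seen S c q2 -> q1 = q2].
Proof.
move=> t xy yS A; have xS : x \notin S by case: t.
have tA q : q \in A -> token S c q.
  rewrite in_setD in_setU1 => /andP[qS /orP[/eqP-> //|qx]].
  exact: token_nbr_swap xy yS qx qS.
have [] // := @cover_rainbow _ k A (seen S c).
- have : #|(x |: nbhd x) :&: S| > 0.
    by apply/card_gt0P; exists y; rewrite !inE yS; move: xy; rewrite inE => ->; rewrite orbT.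
  have := cardsID S (x |: nbhd x); rewrite -/A cardsU1 nbhd_irrefl.
  by have := deg_le x; lia.
- by move=> q /tA/token_in_le1; apply: leq_trans; apply: card_seen.
- by move=> a; apply: token_sees.
Qed.

(** * Excluding a token without neighbours in [S] *)

Section NoPartner.
Variables (S : {set G}) (c : {ffun G -> option 'I_k}) (x : G).
Variable f : {ffun G -> 'I_k.-1}.
Hypotheses (tok_x : token S c x) (disj : [disjoint nbhd x & S]).
Hypothesis f_proper : proper_off (x |: S) f.

Let out q : q \in nbhd x -> q \notin S.
Proof. by move=> xq; rewrite (disjointFr disj xq). Qed.

(** With [s] in [S], the rainbow property around [q] would make [x] see a color, though no neighbour
    of [x] is in [S]. *)
Lemma lone_token_nbr q s : q \in nbhd x -> token S c q -> s \in nbhd q ->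
  s \notin S.
Proof.
move=> xq tq qs; apply/negP => sS.
have [_ seen_nbr _] := token_partner_rainbow tq qs sS; have [|a] := seen_nbr x.
  by rewrite in_setD in_setU1 -nbhd_sym xq orbT; case: tok_x => ->.
by case/seenP=> s' [/out/negP].
Qed.

(* If [f] is not onto off [w], then [w] is the only neighbour of its color. *)
Lemma lone_token_split w : w \in nbhd x ->
  token S c w \/
  {in nbhd x :\ w &, injective f} /\
  forall j, exists2 q, q \in nbhd x :\ w & f q = j.
Proof.
move=> xw.
have [/forallP onto|] := boolP [forall j, exists q in nbhd x :\ w, f q == j].
  have ontoP j : exists2 q, q \in nbhd x :\ w & f q = j.
    by have /exists_inP[q qA /eqP] := onto j; exists q.
  right; split=> //; apply/imset_injP; rewrite eqn_leq leq_imset_card.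
  apply: leq_trans (card_onto ontoP).
  by have := deg_le x; rewrite (cardsD1 w) xw; lia.
rewrite negb_forall => /existsP[j /exists_inPn Hj]; left.
apply: (token_swap tok_x (out xw)); apply: (colorable_off_swap f_proper).
have [q qx fq] := colors_seen j f_proper (token_ncol tok_x).
have qw : q = w.
  apply/eqP; apply: contraT => qw; have := Hj q; rewrite fq eqxx.
  by move: qx; rewrite in_setD in_setD1 qw => /andP[_ ->] /(_ isT).
move=> v; rewrite in_setD => /andP[_ xv] vw.
by rewrite -qw fq; apply: Hj; rewrite in_setD1 vw.
Qed.

(** [w] has too many neighbours in [S] to be a token, so [f] is injective on the other neighbours of
    [x], and only [w] can share the color of [q]. *)
Lemma lone_token_big w q : w \in nbhd x -> 1 < #|nbhd w :&: S| ->
  q \in nbhd x -> q != w -> token S c q.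
Proof.
move=> xw w_big xq qw; apply: (token_swap tok_x (out xq)).
have [|[f_inj _]] := lone_token_split xw; first by move/token_in_le1; lia.
have xS : x \notin S by case: tok_x.
have f_injA v : v \in nbhd x -> v != q -> v != w -> f v != f q.
  move=> xv vq vw; apply: contraNneq vq => fvq; apply/eqP/f_inj => //.
    by rewrite in_setD1 vw.
  by rewrite in_setD1 qw.
have [fqw|fqw] := eqVneq (f w) (f q); last first.
  apply: (colorable_off_swap f_proper) => v; rewrite in_setD => /andP[_ xv] vq.
  by have [->|vw] := eqVneq v w; last exact: f_injA.
(* [w] has three neighbours in [x |: S], so it can be recolored, which makes [q]
   the only neighbour of [x] of its color. *)
pose B := nbhd w :\: (x |: S).
have [j jB] : exists j, j \notin f w |: f @: B.
  apply/existsP; rewrite -negb_forall; apply/negP => /forallP full.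
  (* [B] has at most [k - 3] elements, so with [f w] at most [k - 2] colors are blocked. *)
  have : k.-1 <= #|f w |: f @: B|.
    rewrite -[X in X <= _]card_ord -cardsT; apply/subset_leq_card/subsetP => j _.
    exact: full.
  have := cardsU1 (f w) (f @: B); have := leq_imset_card f B.
  have := cardsID (x |: S) (nbhd w); rewrite -/B setIUr cardsU.
  have -> : nbhd w :&: [set x] :&: (nbhd w :&: S) = set0.
    apply/setP => v; rewrite !inE.
    by have [->|] := eqVneq v x; rewrite ?(negPf xS) ?andbF.
  have -> : nbhd w :&: [set x] = [set x].
    by apply/setIidPr; rewrite sub1set nbhd_sym.
  rewrite cards0 cards1; have := deg_le w; case: (f w \notin _) => /=; lia.
move: jB; rewrite in_setU1 negb_or => /andP[jw jB].
have f'_proper : proper_off (x |: S) (upd f w j).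
  apply: proper_off_upd; first exact: proper_off_sub (subsetUr _ _) f_proper.
  by move=> v vB; apply: contraNneq jB => <-; apply: imset_f.
apply: (colorable_off_swap f'_proper) => v.
rewrite in_setD !ffunE (negPf qw) => /andP[_ xv] vq.
by have [_|vw] := eqVneq v w; [rewrite -fqw | exact: f_injA].
Qed.

Lemma lone_token_absurd : False.
Proof.
have xS : x \notin S by case: tok_x.
have sees a : exists2 q, q \in nbhd x & a \in seen S c q.
  have [q] := token_sees a tok_x; rewrite in_setD in_setU1 => /andP[_].
  case/orP=> [/eqP-> /seenP[s [/out/negP//]]|]; by exists q.
(* All neighbours of [x] other than such a [w] are tokens and see no color, so [w] alone would see
   all [k], besides being adjacent to [x]. *)
have [/exists_inP[w xw w_big]|] := boolP [exists w in nbhd x, 1 < #|nbhd w :&: S|].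
  suff : k <= #|nbhd w :&: S|.
    have := cardsID S (nbhd w); have := deg_le w.
    have : 0 < #|nbhd w :\: S|; last by lia.
    by apply/card_gt0P; exists x; rewrite in_setD xS nbhd_sym.
  apply: leq_trans (card_seen S c w); rewrite -[X in X <= _]card_ord -cardsT.
  apply/subset_leq_card/subsetP => a _; have [q xq aq] := sees a.
  have [<-//|qw] := eqVneq q w; case/seenP: aq => s [qs sS _].
  by have := lone_token_nbr xq (lone_token_big xw w_big xq qw) qs; rewrite sS.
(* Now each neighbour sees at most one of the [k] colors, so each sees exactly one and none is a
   token. *)
move=> /exists_inPn small.
have [|all_seen _] := cover_rainbow (deg_le x) _ sees.
  by move=> q xq; apply: leq_trans (card_seen _ _ _) _; rewrite leqNgt small.
have no_tok q : q \in nbhd x -> ~ token S c q.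
  move=> xq tq; have [a /seenP[s [qs sS _]]] := all_seen q xq.
  by have := lone_token_nbr xq tq qs; rewrite sS.
have [w xw _] := sees (Ordinal (ltn_trans (isT : 0 < 2) k_ge3)).
have [/no_tok|[f_inj onto]] := lone_token_split xw; first exact.
(* [k >= 3] provides a second color [j]; the neighbour [q] of that color is then the only one, hence
   a token. *)
have [j jw] : exists j, j != f w.
  have := cardsC1 (f w); rewrite card_ord => cC.
  have /card_gt0P[j] : 0 < #|[set~ f w]| by lia.
  by rewrite !inE; exists j.
have [q] := onto j; rewrite in_setD1 => /andP[qw xq] fq.
apply: (no_tok q xq); apply: (token_swap tok_x (out xq)).
apply: (colorable_off_swap f_proper) => v; rewrite in_setD => /andP[_ xv] vq.
have [->|vw] := eqVneq v w; first by rewrite fq eq_sym.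
apply: contraNneq vq => fvq; apply/eqP/f_inj; rewrite // in_setD1 ?vw //.
by rewrite qw.
Qed.

End NoPartner.

(** * Exchanging the token with a colored vertex *)

Lemma token_partner S c x : token S c x -> exists2 y, y \in nbhd x & y \in S.
Proof.
move=> t; have [disj|] := boolP [disjoint nbhd x & S].
  by have [_ /existsP[f Hf] _ _ _] := t; case: (lone_token_absurd t disj Hf).
by case/pred0Pn => y /andP[]; exists y.
Qed.

(** By the rainbow property, another vertex of color [a] close to [x] would be seen from the same
    [q] as [y]; but [q] has only one neighbour in [S]. *)
Lemma token_exchange S c x y a : token S c x -> y \in S -> close x y ->
  c y = Some a -> token (x |: S :\ y) (upd c x (Some a)) y.
Proof.
move=> t yS xy cy; have [xS cS vS cardS unc] := t.
have [z xz zS] := token_partner t.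
have [tA _ rainbow] := token_partner_rainbow t xz zS.
have xSy : x \notin S :\ y by rewrite in_setD1 (negPf xS) andbF.
split.
- rewrite in_setU1 in_setD1 eqxx orbF; by apply: contraNneq xS => <-.
- by rewrite setUCA setD1K.
- apply: valid_upd => // [|s]; first exact: valid_sub (subsetDl _ _) vS.
  rewrite in_setD1 => /andP[sy sS] cs; apply: contra sy => xs; apply/eqP.
  have [q qA qs] := token_close t sS xs; have [q' q'A q'y] := token_close t yS xy.
  have eq_q : q = q'.
    by apply: (rainbow q q' a) => //; apply/seenP; [exists s | exists y].
  have /card_le1_eqP in_eq := token_in_le1 (tA q qA).
  by apply: in_eq; rewrite in_setI ?qs // eq_q q'y.
- by rewrite cardsU1 xSy -cardS (cardsD1 y S) yS.
- rewrite uncolored_upd //; apply: leq_ltn_trans unc; apply/subset_leq_card.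
  by apply/subsetP => v; rewrite !inE -andbA => /and3P[_ -> ->].
Qed.

Lemma no_token S c x : ~ token S c x.
Proof.
move=> t; have [y xy yS] := token_partner t; have xS : x \notin S by case: t.
have [_ seen_nbr _] := token_partner_rainbow t xy yS; have [|a] := seen_nbr x.
  by rewrite !inE eqxx xS.
have y_only s : s \in nbhd x -> s \in S -> s = y.
  move=> xs sS; have /card_le1_eqP in_eq := token_in_le1 t.
  by apply: in_eq; rewrite in_setI ?xs ?xy.
case/seenP=> s [xs sS cs]; rewrite (y_only s xs sS) in cs.
have t1 : token (x |: S :\ y) (upd c x (Some a)) y.
  by apply: token_exchange => //; rewrite /close; move: xy; rewrite inE => ->.
have xS1 : x \in x |: S :\ y by rewrite setU11.
have yx : x \in nbhd y by rewrite nbhd_sym.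
have : 0 < #|nbhd y :\: (x |: S :\ y)|.
  apply: leq_trans (nbhd_out_ge _ (token_ncol t1)); first by lia.
  by case: t1.
case/card_gt0P=> z; rewrite in_setD => /andP[zS1 yz].
(* [x] is now the neighbour of [y] in the new set, so [z] can receive the token. *)
have t2 := token_nbr_swap t1 yx xS1 yz zS1.
have zy : y \in nbhd z by rewrite nbhd_sym.
have yS1 : y \notin x |: S :\ y by case: t1.
have seen_x q : x \in nbhd q -> a \in seen (x |: S :\ y) (upd c x (Some a)) q.
  by move=> qx; apply/seenP; exists x; rewrite ffunE eqxx.
have t3 : token (z |: (x |: S :\ y) :\ x)
                (upd (upd c x (Some a)) z (Some a)) x.
  apply: token_exchange t2 xS1 _ _; last by rewrite ffunE eqxx.
  apply/orP; right; apply/existsP; exists y.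
  by move: zy yx; rewrite !inE => -> ->.
have [s' xs'] := token_partner t3.
(* If the new partner of [x] is [z], then [z] and [y] both see the color of [x], against the rainbow
   property around [z]; otherwise it is in [S - y], where [x] has no neighbour. *)
rewrite in_setU1 in_setD1 in_setU1 in_setD1 => /orP[/eqP s'z|].
  have zx : x \in nbhd z by rewrite nbhd_sym -s'z.
  have [_ _ rainbow] := token_partner_rainbow t2 zx xS1.
  have zy' : z = y.
    apply: (rainbow z y a); [| |exact: seen_x |exact: seen_x].
      by rewrite in_setD zS1 in_setU1 eqxx.
    by rewrite in_setD yS1 in_setU1 zy orbT.
  by move: yz; rewrite zy' (negPf (nbhd_irrefl y)).
case/andP=> s'x; rewrite (negPf s'x) /= => /andP[s'y s'S].
by rewrite (y_only s' xs' s'S) eqxx in s'y.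
Qed.

End Token.

(** * Extremal choice and assembly of the classes *)

Theorem theorem5p1 (k : nat) (G : sgraph) :
  3 <= k -> max_degree G <= k ->
  packing_colorable (nseq k.-1 1 ++ nseq k 2) G.
Proof.
move=> k_ge3 max_deg.
have deg_le (x : G) : #|nbhd x| <= k.
  exact: leq_trans (leq_bigmax (F := @degree G) x) max_deg.
have k1_gt0 : 0 < k.-1 by lia.
have colT : colorable_off (G := G) k.-1 setT.
  apply/existsP; exists [ffun=> Ordinal k1_gt0]; apply/proper_offP => u v.
  by rewrite in_setT.
pose R0 := [arg min_(R < [set: G] | colorable_off k.-1 R) #|R|].
have [colR0 R0_min] : colorable_off k.-1 R0 /\
    forall R : {set G}, colorable_off k.-1 R -> #|R0| <= #|R|.
  by rewrite /R0; case: arg_minnP.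
pose admissible (p : {set G} * {ffun G -> option 'I_k}) :=
  [&& colorable_off k.-1 p.1, #|p.1| == #|R0| & valid p.1 p.2].
have adm0 : admissible (R0, [ffun=> None]).
  rewrite /admissible /= colR0 eqxx; apply/validP => u v a _ _ _.
  by rewrite ffunE.
pose p0 := [arg min_(p < (R0, [ffun=> None]) | admissible p) #|uncolored p.1 p.2|].
have [] : admissible p0 /\ forall p, admissible p ->
    #|uncolored p0.1 p0.2| <= #|uncolored p.1 p.2|.
  by rewrite /p0; case: arg_minnP.
case: p0 => R c /=; rewrite /admissible /= => /and3P[colR /eqP cardR validR] c_min.
have all_colored : uncolored R c = set0.
  apply/eqP; apply: contraT => /set0Pn[x]; rewrite inE => /andP[xR cx].
  have [] := @no_token G k #|R0| #|uncolored R c| k_ge3 deg_le R0_min _ (R :\ x) c x.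
    move=> R' c' colR' cardR' valR'; apply: (c_min (R', c')).
    by rewrite /= colR' cardR' eqxx.
  split; rewrite ?in_setD1 ?eqxx ?setD1K //.
  - exact: valid_sub (subsetDl _ _) validR.
  - by rewrite -cardR (cardsD1 x R) xR.
  apply: proper_card; apply/properP; split.
    by apply/subsetP => v; rewrite !inE -andbA => /and3P[_ -> ->].
  by exists x; rewrite !inE ?xR ?eqxx.
have cR x : x \in R -> exists a, c x = Some a.
  move=> xR; case cx: (c x) => [a|]; first by exists a.
  by have := in_set0 x; rewrite -all_colored inE xR cx.
have /existsP[f /proper_offP f_proper] := colR.
(* Numbers below [k - 1] come from [f], the next [k] from [c]; the default 0 never occurs, since all
   of [R] is colored. *)
pose col x : nat := if x \in R then k.-1 + oapp val 0 (c x) else f x.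
set L := _ ++ _; have sizeL : size L = k.-1 + k by rewrite size_cat !size_nseq.
exists (fun i : 'I_(size L) => [set x | col x == i]); split.
- move=> x; suff col_lt : col x < size L by exists (Ordinal col_lt); rewrite inE.
  rewrite sizeL /col; case: ifP => [/cR[a ->] /=|_].
    by rewrite ltn_add2l.
  exact: ltn_addr.
- move=> i j ij; rewrite -setI_eq0; apply/eqP/setP => x; rewrite !inE.
  apply/negP => /andP[/eqP xi /eqP xj]; case/eqP: ij; apply: val_inj.
  by rewrite /= -xi -xj.
move=> i x y; rewrite !inE => /eqP xi /eqP; rewrite -xi nth_cat size_nseq !nth_nseq.
rewrite /col; case: (boolP (x \in R)) => [xR|xR]; case: (boolP (y \in R)) => [yR|yR].
- have [a cx] := cR x xR; have [b cy] := cR y yR; rewrite cx cy /= => ab xy.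
  have {}ab : b = a by apply: val_inj; apply/eqP; rewrite -(eqn_add2l k.-1) ab.
  rewrite ltnNge leq_addr addKn ltn_ord; apply: dist_gt2 => //.
  by move/validP: validR; apply; rewrite // ?cx ?cy ?ab.
- by have := ltn_ord (f y); lia.
- by have := ltn_ord (f x); lia.
move=> /val_inj fxy xy; rewrite ltn_ord; apply: dist_gt1 => //.
by apply: contraTN (eqxx (f x)) => xadj; rewrite -{2}fxy f_proper.
Qed.
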